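(* Let $\Phi=\sum_{A,B'}\Phi_{AB'}\theta^{AB'}+\Phi_T\theta$ be a (smooth) matrix-valued connection form on the real Heisenberg group $\mathscr H^{\mathbb R}$, with curvature $F=\mathrm d\Phi+\Phi\wedge\Phi$, and let $F_V$ and $F_H^+$ be its vertical part and the self-dual part of its horizontal part. (1) $F_H^+=0$ is equivalent to $F(V_0,V_1)=0$ (for all $0\ne(\pi_{0'},\pi_{1'})\in\mathbb{C}^2$, where $V_A=\pi_{0'}V_{A0'}-\pi_{1'}V_{A1'}$), i.e. to $$V_{00'}(\Phi_{10'})-V_{10'}(\Phi_{00'})+[\Phi_{00'},\Phi_{10'}]=0,$$ $$V_{01'}(\Phi_{10'})+V_{00'}(\Phi_{11'})-V_{10'}(\Phi_{01'})-V_{11'}(\Phi_{00'})+[\Phi_{00'},\Phi_{11'}]+[\Phi_{01'},\Phi_{10'}]=0,$$ $$V_{01'}(\Phi_{11'})-V_{11'}(\Phi_{01'})+[\Phi_{01'},\Phi_{11'}]=0.$$ (2) $F_V=0$ is equivalent to $V_{AB'}(\Phi_T)-T(\Phi_{AB'})+[\Phi_{AB'},\Phi_T]=0$ for all $A=0,1$, $B'=0',1'$.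
   Context: $\mathscr H^{\mathbb R}=\mathbb{R}^5$ with coordinates $(y_1,y_2,y_3,y_4,s)$ and multiplication $(\mathbf y,s)\circ(\mathbf y',s')=(\mathbf y+\mathbf y',s+s'+2(y_1y_2'-y_2y_1'-y_3y_4'+y_4y_3'))$. It is embedded in the complex Heisenberg group by $y_{00'}=y_1+\mathbf i y_2$, $y_{01'}=-y_3+\mathbf i y_4$, $y_{10'}=y_3+\mathbf i y_4$, $y_{11'}=y_1-\mathbf i y_2$, $t=-\mathbf i s$, giving the complex left invariant vector fields $V_{00'}=\frac12(\partial_{y_1}-\mathbf i\partial_{y_2})-\mathbf i(y_1-\mathbf i y_2)\partial_s$, $V_{01'}=\frac12(-\partial_{y_3}-\mathbf i\partial_{y_4})+\mathbf i(y_3+\mathbf i y_4)\partial_s$, $V_{10'}=\frac12(\partial_{y_3}-\mathbf i\partial_{y_4})+\mathbf i(y_3-\mathbf i y_4)\partial_s$, $V_{11'}=\frac12(\partial_{y_1}+\mathbf i\partial_{y_2})+\mathbf i(y_1+\mathbf i y_2)\partial_s$, $T=\mathbf i\partial_s$, with dual forms $\theta^{00'}=\mathrm dy_1+\mathbf i\,\mathrm dy_2$, $\theta^{01'}=-\mathrm dy_3+\mathbf i\,\mathrm dy_4$, $\theta^{10'}=\mathrm dy_3+\mathbf i\,\mathrm dy_4$, $\theta^{11'}=\mathrm dy_1-\mathbf i\,\mathrm dy_2$, $\theta=-\mathbf i\,\mathrm ds+2\mathbf i(y_1\mathrm dy_2-y_2\mathrm dy_1+y_4\mathrm dy_3-y_3\mathrm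 dy_4)$. For a $2$-form $F$: $F_V=\theta\wedge\iota_TF$ up to sign convention, i.e. the part of $F$ consisting of terms $\theta^{AB'}\wedge\theta$, and $F_H=\iota_T(\theta\wedge F)$ is the horizontal part, consisting of terms $\theta^{AB'}\wedge\theta^{CD'}$; thus $F=F_H+F_V$ and $\iota_TF_H=0$. Horizontal $2$-forms are the combinations of $\mathrm dy_i\wedge\mathrm dy_j$, $1\le i<j\le4$. On them let $\star$ (the paper's $\iota_T\ast$: Hodge star of the $5$-dimensional metric followed by contraction with the unit vertical vector) be the linear involution exchanging $\mathrm dy_1\wedge\mathrm dy_2\leftrightarrow\mathrm dy_3\wedge\mathrm dy_4$, $\mathrm dy_1\wedge\mathrm dy_3\leftrightarrow-\mathrm dy_2\wedge\mathrm dy_4$, $\mathrm dy_1\wedge\mathrm dy_4\leftrightarrow\mathrm dy_2\wedge\mathrm dy_3$. A horizontal $2$-form $\omega$ is self-dual if $\star\omega=\omega$ and anti-self-dual if $\star\omega=-\omega$; $F_H^+=\frac12(1+\star)F_H$. *)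

(* Defs.v *)
From mathcomp Require Import all_boot all_order all_algebra.
From mathcomp Require Import complex.
From mathcomp Require Import all_classical all_reals all_analysis.

Set Implicit Arguments.
Unset Strict Implicit.
Unset Printing Implicit Defensive.

Import Order.TTheory GRing.Theory Num.Theory.
Import numFieldNormedType.Exports.

Local Open Scope ring_scope.
Local Open Scope complex_scope.

Definition heis (R : realType) := 'rV[R]_5.

Definition y1 : 'I_5 := @Ordinal 5 0 isT.
Definition y2 : 'I_5 := @Ordinal 5 1 isT.
Definition y3 : 'I_5 := @Ordinal 5 2 isT.
Definition y4 : 'I_5 := @Ordinal 5 3 isT.
Definition ys : 'I_5 := @Ordinal 5 4 isT.

(* The group law for which the fields V and T below are left invariant. *)
Definition heis_mul (R : realType) (p q : heis R) : heis R :=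
  p + q + (2 * (p 0 y1 * q 0 y2 - p 0 y2 * q 0 y1
                - p 0 y3 * q 0 y4 + p 0 y4 * q 0 y3)) *: delta_mx 0 ys.

Definition ycoord (R : realType) (j : 'I_5) (p : heis R) : R[i] := (p 0 j)%:C.

(* Complexified tangent vectors, in the frame of coordinate fields. *)
Definition tvec (R : realType) := 'rV[R[i]]_5.
Definition pd (R : realType) (j : 'I_5) : tvec R := delta_mx 0 j.
Definition vfield (R : realType) := heis R -> tvec R.

Section Smooth.
Variables (R : realType) (n : nat).

(* C^oo: every iterated directional derivative is differentiable. *)
Definition smooth_real (f : heis R -> R) : Prop :=
  forall (s : seq (heis R)) (p : heis R),
    differentiable (foldr (fun v (g : heis R -> R) => 'D_v g) f s) p.

Definition smooth (f : heis R -> 'M[R[i]]_n) : Prop :=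
  forall i j, smooth_real (fun p => complex.Re (f p i j)) /\
              smooth_real (fun p => complex.Im (f p i j)).

Definition partial (j : 'I_5) (f : heis R -> 'M[R[i]]_n) (p : heis R) :
    'M[R[i]]_n :=
  \matrix_(k, l)
    ('D_(delta_mx 0 j) (fun q => complex.Re (f q k l) : R) p
     +i* 'D_(delta_mx 0 j) (fun q => complex.Im (f q k l) : R) p).

Definition dirder (u : tvec R) (f : heis R -> 'M[R[i]]_n) (p : heis R) :
    'M[R[i]]_n :=
  \sum_j u 0 j *: partial j f p.

Definition vder (X : vfield R) (f : heis R -> 'M[R[i]]_n) (p : heis R) :
    'M[R[i]]_n :=
  dirder (X p) f p.

Definition mxbracket (A B : 'M[R[i]]_n) : 'M[R[i]]_n := A *m B - B *m A.

End Smooth.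

(* Forms are given by their values on complexified tangent vectors.  The
   wedge product and d carry no factor 1/2, so that
   (dx /\ dy) (d/dx, d/dy) = 1. *)
Definition form1 (R : realType) (E : Type) := heis R -> tvec R -> E.
Definition form2 (R : realType) (E : Type) := heis R -> tvec R -> tvec R -> E.
Definition form3 (R : realType) (E : Type) :=
  heis R -> tvec R -> tvec R -> tvec R -> E.

Section Forms.
Variables (R : realType) (n : nat).
Local Notation C := R[i].
Local Notation M := 'M[R[i]]_n.

(* The constant extensions of u and v commute, so d has no bracket term. *)
Definition dform1 (w : form1 R M) : form2 R M := fun p u v =>
  dirder u (fun q => w q v) p - dirder v (fun q => w q u) p.

Definition wedge_mx (a b : form1 R M) : form2 R M := fun p u v =>
  a p u *m b p v - a p v *m b p u.

Definition wedge11 (a : form1 R C) (b : form1 R M) : form2 R M := fun p u v =>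
  a p u *: b p v - a p v *: b p u.

Definition wedge12 (a : form1 R C) (b : form2 R M) : form3 R M := fun p u v w =>
  a p u *: b p v w - a p v *: b p u w + a p w *: b p u v.

Definition contract2 (X : vfield R) (w : form2 R M) : form1 R M :=
  fun p => w p (X p).
Definition contract3 (X : vfield R) (w : form3 R M) : form2 R M :=
  fun p => w p (X p).

Definition dy (j : 'I_5) : form1 R C := fun _ u => u 0 j.
Definition dydy (j k : 'I_5) (p : heis R) (u v : tvec R) : C :=
  dy j p u * dy k p v - dy j p v * dy k p u.

End Forms.

Section Heisenberg.
Variable R : realType.

(* A and B stand for the spinor indices A = 0, 1 and B' = 0', 1'. *)
Definition V (A B : 'I_2) : vfield R := fun p =>
  match val A, val B with
  | 0%N, 0%N => 2^-1 *: (pd R y1 - 'i *: pd R y2)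
                - ('i * (ycoord y1 p - 'i * ycoord y2 p)) *: pd R ys
  | 0%N, _ => 2^-1 *: (- pd R y3 - 'i *: pd R y4)
              + ('i * (ycoord y3 p + 'i * ycoord y4 p)) *: pd R ys
  | _, 0%N => 2^-1 *: (pd R y3 - 'i *: pd R y4)
              + ('i * (ycoord y3 p - 'i * ycoord y4 p)) *: pd R ys
  | _, _ => 2^-1 *: (pd R y1 + 'i *: pd R y2)
            + ('i * (ycoord y1 p + 'i * ycoord y2 p)) *: pd R ys
  end.

Definition T : vfield R := fun _ => 'i *: pd R ys.

Definition thetaAB (A B : 'I_2) : form1 R R[i] := fun p u =>
  match val A, val B with
  | 0%N, 0%N => dy y1 p u + 'i * dy y2 p u
  | 0%N, _ => - dy y3 p u + 'i * dy y4 p u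
  | _, 0%N => dy y3 p u + 'i * dy y4 p u
  | _, _ => dy y1 p u - 'i * dy y2 p u
  end.

Definition theta : form1 R R[i] := fun p u =>
  - 'i * dy ys p u
  + 2 * 'i * (ycoord y1 p * dy y2 p u - ycoord y2 p * dy y1 p u
              + ycoord y4 p * dy y3 p u - ycoord y3 p * dy y4 p u).

Definition Vpi (pi0 pi1 : R[i]) (A : 'I_2) : vfield R := fun p =>
  pi0 *: V A 0 p - pi1 *: V A 1 p.

Variable n : nat.
Local Notation M := 'M[R[i]]_n.

Definition connection (Phi : 'I_2 -> 'I_2 -> heis R -> M) (PhiT : heis R -> M) :
    form1 R M := fun p u =>
  (\sum_A \sum_B thetaAB A B p u *: Phi A B p) + theta p u *: PhiT p.

Definition curvature (w : form1 R M) : form2 R M := fun p u v =>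
  dform1 w p u v + wedge_mx w w p u v.

Definition vert (F : form2 R M) : form2 R M := wedge11 theta (contract2 T F).
Definition horiz (F : form2 R M) : form2 R M := contract3 T (wedge12 theta F).

(* The involution dy_12 <-> dy_34, dy_13 <-> - dy_24, dy_14 <-> dy_23 of the
   horizontal 2-forms; the coefficient of dy_jk in a horizontal form w is
   w (d/dy_j, d/dy_k).  Only meaningful on horizontal forms. *)
Definition star (w : form2 R M) : form2 R M := fun p u v =>
  let c j k := w p (pd R j) (pd R k) in
  dydy y3 y4 p u v *: c y1 y2 + dydy y1 y2 p u v *: c y3 y4
  - dydy y2 y4 p u v *: c y1 y3 - dydy y1 y3 p u v *: c y2 y4
  + dydy y2 y3 p u v *: c y1 y4 + dydy y1 y4 p u v *: c y2 y3.

Definition horiz_plus (F : form2 R M) : form2 R M := fun p u v =>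
  2^-1 *: (horiz F p u v + star (horiz F) p u v).

End Heisenberg.

(* Main.v *)
(** The curvature is evaluated on the frame [V A B], [T], dual to the coframe
    [thetaAB A B], [theta]: there it is the derivative terms plus the bracket,
    up to the defect [d theta (V A B, V C D) * PhiT].  That defect vanishes on
    (V00', V10') and on (V01', V11'), and is -2 resp. 2 on (V00', V11') and
    (V01', V10'), so it cancels in the sum that occurs in F(V_0, V_1), which is
    a quadratic form in (pi_0', pi_1').  Since [theta] kills the [V A B], the
    same values of F are values of its horizontal part, and they are linear
    combinations of the three self-dual coefficients F_12 + F_34, F_13 - F_24,
    F_14 + F_23. *)
From HB Require Import structures.
Require Import Defs.
From mathcomp Require Import all_boot all_order all_algebra.
From mathcomp Require Import complex ring.
From mathcomp Require Import all_classical all_reals all_analysis.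

Set Implicit Arguments.
Unset Strict Implicit.
Unset Printing Implicit Defensive.

Import Order.TTheory GRing.Theory Num.Theory.
Import numFieldNormedType.Exports.

Local Open Scope ring_scope.

(** * Coordinate derivatives of complex-valued functions *)

Section ComplexDerivative.
Variables (R : realType) (j : 'I_5) (p : heis R).
Implicit Types (f g : heis R -> R[i]) (a b : R[i]).

(** Split into real and imaginary parts because [heis R] is a real normed space and [partial] is
    itself defined componentwise. *)
Definition is_cderive f a : Prop :=
  is_derive p (delta_mx 0 j) (fun q => complex.Re (f q) : R) (complex.Re a) /\
  is_derive p (delta_mx 0 j) (fun q => complex.Im (f q) : R) (complex.Im a).

(** Lets the rules below synthesize a derivative first, leaving its comparison with the wanted value
    to [ring]. *)
Lemma is_cderive_eq f a b : is_cderive f a -> a = b -> is_cderive f b.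
Proof. by move=> ? <-. Qed.

Lemma is_cderive_cst a : is_cderive (fun=> a) 0.
Proof. by split; exact: is_derive_cst. Qed.

Lemma is_cderiveD f g a b :
  is_cderive f a -> is_cderive g b -> is_cderive (fun q => f q + g q) (a + b).
Proof.
case: a b => [a a'] [b b'] [/= fa fa'] [/= gb gb']; split=> /=.
- rewrite (_ : (fun q => _) = (fun q => complex.Re (f q)) + (fun q => complex.Re (g q))).
    exact: is_deriveD.
  by apply/funext => q; rewrite fctE; case: (f q) (g q) => [? ?] [].
- rewrite (_ : (fun q => _) = (fun q => complex.Im (f q)) + (fun q => complex.Im (g q))).
    exact: is_deriveD.
  by apply/funext => q; rewrite fctE; case: (f q) (g q) => [? ?] [].
Qed.

Lemma is_cderiveM f g a b : is_cderive f a -> is_cderive g b ->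
  is_cderive (fun q => f q * g q) (a * g p + f p * b).
Proof.
case: a b => [a a'] [b b'] [/= fa fa'] [/= gb gb']; split=> /=.
- rewrite (_ : (fun q => _) =
    (fun q => complex.Re (f q)) * (fun q => complex.Re (g q))
    - (fun q => complex.Im (f q)) * (fun q => complex.Im (g q))).
    apply: is_derive_eq; rewrite /GRing.scale /=.
    by case: (f p) (g p) => [? ?] [? ?] /=; ring.
  by apply/funext => q; rewrite !fctE; case: (f q) (g q) => [? ?] [].
- rewrite (_ : (fun q => _) =
    (fun q => complex.Re (f q)) * (fun q => complex.Im (g q))
    + (fun q => complex.Im (f q)) * (fun q => complex.Re (g q))).
    apply: is_derive_eq; rewrite /GRing.scale /=.
    by case: (f p) (g p) => [? ?] [? ?] /=; ring.
  by apply/funext => q; rewrite !fctE; case: (f q) (g q) => [? ?] [].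
Qed.

Lemma is_cderiveN f a : is_cderive f a -> is_cderive (fun q => - f q) (- a).
Proof.
move=> fa; have := is_cderiveM (is_cderive_cst (-1)) fa.
rewrite mul0r add0r mulN1r; congr is_cderive.
by apply/funext => q; rewrite mulN1r.
Qed.

Lemma is_cderiveB f g a b :
  is_cderive f a -> is_cderive g b -> is_cderive (fun q => f q - g q) (a - b).
Proof. by move=> fa gb; apply/is_cderiveD/is_cderiveN. Qed.

Lemma is_cderive_ycoord k : is_cderive (ycoord k) (j == k)%:R.
Proof.
split => /=.
- pose c := fun q : heis R => q 0 k : R.
  have cL : linear c by move=> r u v; rewrite /c !mxE.
  (* The coordinate is packaged as a linear map so that [diff_lin] applies: its differential is
     itself, and its value on the [j]-th basis vector is the Kronecker delta. *)
  pose L := GRing.isLinear.Build _ _ _ _ c cL.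
  pose cl : {linear heis R -> R} := HB.pack c L.
  have dc : differentiable (cl : heis R -> R) p by exact: differentiable_coord.
  apply: DeriveDef; first exact/diff_derivable.
  rewrite (deriveE _ dc) (@diff_lin _ _ _ cl p) /=; last exact: coord_continuous.
  by rewrite /c mxE eqxx eq_sym; case: (_ == _).
- apply: is_derive_eq; by case: (_ == _).
Qed.

End ComplexDerivative.

Lemma sum_ord2 (U : nmodType) (f : 'I_2 -> U) : \sum_A f A = f 0 + f 1.
Proof. by rewrite big_ord_recl big_ord1; congr (f _ + f _); apply/val_inj. Qed.

Lemma sum_ord5 (U : nmodType) (f : 'I_5 -> U) :
  \sum_j f j = f y1 + f y2 + f y3 + f y4 + f ys.
Proof.
rewrite !big_ord_recl big_ord0 addr0 !addrA.
by congr (f _ + f _ + f _ + f _ + f _); apply/val_inj.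
Qed.

(** * Partial derivatives of matrix-valued functions *)

Section PartialDerivatives.
Variables (R : realType) (n : nat).
Implicit Types f : heis R -> 'M[R[i]]_n.

Lemma smooth_is_cderive f (f_smooth : smooth f) j p k l :
  is_cderive j p (fun q => f q k l) (partial j f p k l).
Proof.
have [re_smooth im_smooth] := f_smooth k l; rewrite /is_cderive mxE /=.
split; apply/derivableP/diff_derivable.
  (* With no directions, the iterated derivative in [smooth_real] is the function itself. *)
  exact: re_smooth [::] p.
exact: im_smooth [::] p.
Qed.

Lemma is_cderive_partial f j p (df : 'M[R[i]]_n) :
  (forall k l, is_cderive j p (fun q => f q k l) (df k l)) -> partial j f p = df.
Proof.
move=> fdf; apply/matrixP => k l; rewrite mxE.
have [re_f im_f] := fdf k l.
by rewrite (@derive_val _ _ _ _ _ _ _ re_f) (@derive_val _ _ _ _ _ _ _ im_f);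
  case: (df k l).
Qed.

End PartialDerivatives.

Local Opaque partial.

(** * Leibniz rule for the connection form *)

Section Connection.
Variables (R : realType) (n : nat).
Variables (Phi : 'I_2 -> 'I_2 -> heis R -> 'M[R[i]]_n) (PhiT : heis R -> 'M[R[i]]_n).
Hypothesis Phi_smooth : forall A B, smooth (Phi A B).
Hypothesis PhiT_smooth : smooth PhiT.

(* No base point: theta is affine in it. *)
Definition dirder_theta (u v : tvec R) : R[i] :=
  2 * 'i * (u 0 y1 * v 0 y2 - u 0 y2 * v 0 y1 + u 0 y4 * v 0 y3 - u 0 y3 * v 0 y4).

Lemma is_cderive_theta j (p : heis R) v :
  is_cderive j p (fun q => theta q v) (dirder_theta (pd R j) v).
Proof.
rewrite /theta.
apply: (@is_cderive_eq R j p).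
  apply: is_cderiveD; first exact: is_cderive_cst.
  apply: is_cderiveM; first exact: is_cderive_cst.
  apply: is_cderiveB; last by apply: is_cderiveM;
    [exact: is_cderive_ycoord | exact: is_cderive_cst].
  apply: is_cderiveD; last by apply: is_cderiveM;
    [exact: is_cderive_ycoord | exact: is_cderive_cst].
  apply: is_cderiveB; by apply: is_cderiveM;
    [exact: is_cderive_ycoord | exact: is_cderive_cst].
rewrite /dirder_theta /pd /dy !mxE /= ![_ == j]eq_sym.
ring.
Qed.

Lemma is_cderive_thetaAB A B j (p : heis R) v :
  is_cderive j p (fun q => thetaAB A B q v) 0.
Proof. exact: (@is_cderive_cst R j p (thetaAB A B p v)). Qed.

(** Since [thetaAB] does not depend on the base point, the only coefficient whose derivative
    survives is [theta], and that derivative multiplies [PhiT]. *)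
Lemma partial_connection j p v :
  partial j (fun q => connection Phi PhiT q v) p =
  connection (fun A B => partial j (Phi A B)) (partial j PhiT) p v
  + dirder_theta (pd R j) v *: PhiT p.
Proof.
apply: is_cderive_partial => k l; rewrite /connection.
under eq_fun do rewrite !sum_ord2 !mxE.
apply: (@is_cderive_eq R j p).
  apply: is_cderiveD; last by apply: is_cderiveM;
    [exact: is_cderive_theta | exact: smooth_is_cderive].
  by apply: is_cderiveD; apply: is_cderiveD;
    (apply: is_cderiveM; [exact: is_cderive_thetaAB | exact: smooth_is_cderive]).
(* [partial] is opaque here, so [mxE] opens sums and scalings but leaves the derivatives of the
   components as atoms for [ring]. *)
rewrite !sum_ord2 !mxE.
ring.
Qed.

Lemma dirder_connection u p v :
  dirder u (fun q => connection Phi PhiT q v) p =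
  connection (fun A B => dirder u (Phi A B)) (dirder u PhiT) p v
  + dirder_theta u v *: PhiT p.
Proof.
rewrite {1}/dirder.
under eq_bigr do rewrite partial_connection scalerDr scalerA.
rewrite big_split /= -scaler_suml; congr (_ + _ *: _); last first.
  rewrite sum_ord5 /dirder_theta /pd !mxE /=.
  ring.
rewrite /connection.
under eq_bigr do rewrite scalerDr.
rewrite big_split /=; congr (_ + _); last first.
  by rewrite /dirder scaler_sumr; apply: eq_bigr => j _; rewrite !scalerA mulrC.
under eq_bigr do rewrite scaler_sumr.
rewrite exchange_big /=; apply: eq_bigr => A _.
under eq_bigr do rewrite scaler_sumr.
rewrite exchange_big /=; apply: eq_bigr => B _.
by rewrite /dirder scaler_sumr; apply: eq_bigr => j _; rewrite !scalerA mulrC.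
Qed.

End Connection.

(** * The frame [V], [T] and its dual coframe *)

Section Frame.
Variable R : realType.
Implicit Types (p : heis R) (A B : 'I_2).

Lemma nonzero2 : (2 : R[i]) != 0. Proof. by rewrite pnatr_eq0. Qed.

Lemma ord2P A : A = 0 \/ A = 1.
Proof. by case: A => [[|[|]]] // i; [left|right]; exact/val_inj. Qed.

(** The four shapes of linear combination occurring in [V]. For variable rows, [mxE] stops at the
    entries of [u], [v], [w]. *)
Lemma frame_coordE (K : pzRingType) (m : nat) (a b c : K) (u v w : 'rV[K]_m) j :
  [/\ (a *: (u - b *: v) - c *: w) 0 j = a * (u 0 j - b * v 0 j) - c * w 0 j,
      (a *: (- u - b *: v) + c *: w) 0 j = a * (- u 0 j - b * v 0 j) + c * w 0 j,
      (a *: (u - b *: v) + c *: w) 0 j = a * (u 0 j - b * v 0 j) + c * w 0 j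
    & (a *: (u + b *: v) + c *: w) 0 j = a * (u 0 j + b * v 0 j) + c * w 0 j].
Proof. by rewrite !mxE. Qed.

Lemma pdE j k : pd R k 0 j = (j == k)%:R.
Proof. by rewrite mxE. Qed.

Lemma V_coord A B p j :
  V A B p 0 j =
  match val A, val B with
  | 0%N, 0%N => 2^-1 * ((j == y1)%:R - 'i * (j == y2)%:R)
                - ('i * (ycoord y1 p - 'i * ycoord y2 p)) * (j == ys)%:R
  | 0%N, _ => 2^-1 * (- (j == y3)%:R - 'i * (j == y4)%:R)
              + ('i * (ycoord y3 p + 'i * ycoord y4 p)) * (j == ys)%:R
  | _, 0%N => 2^-1 * ((j == y3)%:R - 'i * (j == y4)%:R)
              + ('i * (ycoord y3 p - 'i * ycoord y4 p)) * (j == ys)%:R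
  | _, _ => 2^-1 * ((j == y1)%:R + 'i * (j == y2)%:R)
            + ('i * (ycoord y1 p + 'i * ycoord y2 p)) * (j == ys)%:R
  end.
Proof.
rewrite -!pdE /V.
case: (val A) => [|_]; case: (val B) => [|_].
- by case: (frame_coordE 2^-1 'i ('i * (ycoord y1 p - 'i * ycoord y2 p))
    (pd R y1) (pd R y2) (pd R ys) j).
- by case: (frame_coordE 2^-1 'i ('i * (ycoord y3 p + 'i * ycoord y4 p))
    (pd R y3) (pd R y4) (pd R ys) j).
- by case: (frame_coordE 2^-1 'i ('i * (ycoord y3 p - 'i * ycoord y4 p))
    (pd R y3) (pd R y4) (pd R ys) j).
- by case: (frame_coordE 2^-1 'i ('i * (ycoord y1 p + 'i * ycoord y2 p))
    (pd R y1) (pd R y2) (pd R ys) j).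
Qed.

Lemma thetaAB_V A B C D p :
  thetaAB A B p (V C D p) = ((A == C) && (B == D))%:R :> R[i].
Proof.
have i2 := sqrCi R[i]; have n2 := nonzero2.
rewrite /thetaAB /dy !V_coord.
case: (ord2P A) => ->; case: (ord2P B) => ->; case: (ord2P C) => ->;
  case: (ord2P D) => -> /=; field: i2.
all: done.
Qed.

(** The [ys] component of each [V A B] is exactly what cancels the terms of [theta] in the other
    four coordinates, so the [V A B] are horizontal. *)
Lemma theta_V A B p : theta p (V A B p) = 0.
Proof.
have i2 := sqrCi R[i]; have n2 := nonzero2.
rewrite /theta /dy !V_coord.
case: (ord2P A) => ->; case: (ord2P B) => -> /=; field: i2.
all: done.
Qed.

Lemma T_coord p j : T p 0 j = 'i * (j == ys)%:R :> R[i].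
Proof. by rewrite -pdE [LHS]mxE. Qed.

Lemma thetaAB_T A B p : thetaAB A B p (T p) = 0 :> R[i].
Proof.
rewrite /thetaAB /dy !T_coord.
by case: (ord2P A) => ->; case: (ord2P B) => -> /=; ring.
Qed.

Lemma theta_T p : theta p (T p) = 1 :> R[i].
Proof. have i2 := sqrCi R[i]; rewrite /theta /dy !T_coord /=; ring: i2. Qed.

End Frame.

(** A quadratic form in two variables is determined by its values at (1, 0), (0, 1) and (1, 1). *)
Lemma quadratic_eq0P (K : fieldType) (M : lmodType K) (X Y Z : M) :
  (forall a b : K, (a, b) <> (0, 0) ->
     a ^+ 2 *: X - (a * b) *: Y + b ^+ 2 *: Z = 0) <->
  [/\ X = 0, Y = 0 & Z = 0].
Proof.
split=> [H|[-> -> ->] a b _]; last by rewrite !scaler0 subr0 addr0.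
have n1 := oner_neq0 K.
have X0 : X = 0.
  rewrite -[RHS](H 1 0); last by case=> /eqP; rewrite (negPf n1).
  by rewrite expr1n mulr0 expr0n !scale0r subr0 addr0 scale1r.
have Z0 : Z = 0.
  rewrite -[RHS](H 0 1); last by case=> /eqP; rewrite (negPf n1).
  by rewrite expr1n mul0r expr0n !scale0r subr0 add0r scale1r.
split=> //; apply/eqP; rewrite -oppr_eq0 -(H 1 1); last first.
  by case=> /eqP; rewrite (negPf n1).
by rewrite X0 Z0 !scaler0 mulr1 scale1r add0r addr0.
Qed.

(** * Skew bilinear forms on a single tangent space *)

Section SkewForms.
Variables (K : numClosedFieldType) (m n : nat).
Variable w : 'rV[K]_m -> 'rV[K]_m -> 'M[K]_n.

Definition skew_bilinear : Prop :=
  (forall a u u' v, w (a *: u + u') v = a *: w u v + w u' v) /\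
  (forall u v, w v u = - w u v).

Hypothesis w_skewbil : skew_bilinear.
Let wP := w_skewbil.1.
Let wC := w_skewbil.2.

Lemma skew0l v : w 0 v = 0.
Proof. by have := wP (-1) 0 0 v; rewrite scaler0 addr0 scaleN1r addNr. Qed.

Lemma skewDl u u' v : w (u + u') v = w u v + w u' v.
Proof. by rewrite -{1}(scale1r u) wP scale1r. Qed.

Lemma skewZl a u v : w (a *: u) v = a *: w u v.
Proof. by rewrite -(addr0 (a *: u)) wP skew0l addr0. Qed.

Lemma skewDr u v v' : w u (v + v') = w u v + w u v'.
Proof. by rewrite wC skewDl opprD -!wC. Qed.

Lemma skewZr a u v : w u (a *: v) = a *: w u v.
Proof. by rewrite wC skewZl -scalerN -wC. Qed.

(** Each entry equals its own opposite, and the characteristic is zero. *)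
Lemma skew_diag u : w u u = 0.
Proof.
apply/matrixP => k l; apply/eqP; rewrite mxE -eqNr.
by rewrite {2}wC mxE.
Qed.

Lemma skew_suml (I : finType) (a : I -> K) (e : I -> 'rV[K]_m) v :
  w (\sum_j a j *: e j) v = \sum_j a j *: w (e j) v.
Proof.
by elim/big_rec2 : _ => [|j x y _ <-]; [exact: skew0l | exact: wP].
Qed.

Lemma skew_sumr (I : finType) (a : I -> K) (e : I -> 'rV[K]_m) u :
  w u (\sum_j a j *: e j) = \sum_j a j *: w u (e j).
Proof.
rewrite wC skew_suml -sumrN; apply: eq_bigr => j _.
by rewrite -scalerN -wC.
Qed.

(** Meant for [x] the value of [T] and [e] the frame [V]: the component along [x] drops out by
    skewness. *)
Lemma skew_frame (I J : finType) (a : I -> J -> K) b (e : I -> J -> 'rV[K]_m) x :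
  w (\sum_i \sum_j a i j *: e i j + b *: x) x = \sum_i \sum_j a i j *: w (e i j) x.
Proof.
rewrite skewDl skewZl skew_diag scaler0 addr0.
rewrite (big_morph (w^~ x) (id1 := 0) (op1 := +%R)); last exact: skew0l.
  by apply: eq_bigr => i _; exact: skew_suml.
by move=> u u'; exact: skewDl.
Qed.

(** The arguments have the shape of [Vpi]; this exhibits $F(V_0,V_1)$ as a quadratic form in
    $(\pi_{0'},\pi_{1'})$. *)
Lemma skew_quadratic (a b : K) x0 x1 z0 z1 :
  w (a *: x0 - b *: x1) (a *: z0 - b *: z1) =
  a ^+ 2 *: w x0 z0 - (a * b) *: (w x0 z1 + w x1 z0) + b ^+ 2 *: w x1 z1.
Proof.
rewrite -(scaleNr b x1) -(scaleNr b z1) !(skewDl, skewZl, skewDr, skewZr).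
by apply/matrixP => k l; rewrite !mxE; ring.
Qed.

Section Projection.
Variables (t : 'rV[K]_m -> K) (X : 'rV[K]_m).
Hypothesis t_linear : forall a u v, t (a *: u + v) = a * t u + t v.
Hypothesis t_X : t X = 1.

(** This is $\iota_X(t\wedge w)$ written out; [horiz F p] is convertible to it for [t] the form
    [theta p] and [X] the vector [T p]. *)
Definition horizontal_part (u v : 'rV[K]_m) : 'M[K]_n :=
  t X *: w u v - t u *: w X v + t v *: w X u.

Lemma horizontal_part_linear a u u' v :
  horizontal_part (a *: u + u') v = a *: horizontal_part u v + horizontal_part u' v.
Proof.
rewrite /horizontal_part t_X t_linear skewDl skewZl skewDr skewZr.
by apply/matrixP => k l; rewrite !mxE; ring.
Qed.

Lemma horizontal_part_skew u v : horizontal_part v u = - horizontal_part u v.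
Proof.
rewrite /horizontal_part t_X (wC u v).
by apply/matrixP => k l; rewrite !mxE; ring.
Qed.

Lemma horizontal_partX v : horizontal_part X v = 0.
Proof. by rewrite /horizontal_part skew_diag scaler0 addr0 subrr. Qed.

Lemma horizontal_part_id u v : t u = 0 -> t v = 0 -> horizontal_part u v = w u v.
Proof.
by rewrite /horizontal_part t_X => -> ->; rewrite !scale0r scale1r subr0 addr0.
Qed.

End Projection.

End SkewForms.

(** * Self-dual coefficients of a horizontal form *)

Section HorizontalForms.
Variables (K : numClosedFieldType) (n : nat).
Variable w : 'rV[K]_5 -> 'rV[K]_5 -> 'M[K]_n.
Hypothesis w_skewbil : skew_bilinear w.
Local Notation e j := (delta_mx 0 j : 'rV[K]_5).
Hypothesis w_horizontal : forall v, w (e ys) v = 0.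

Let w_horizontalr u : w u (e ys) = 0.
Proof. by rewrite w_skewbil.2 w_horizontal oppr0. Qed.

(** Up to a factor 1/2, these three are the coordinates of the self-dual part of [w] in the basis
    $dy_{12}+dy_{34}$, $dy_{13}-dy_{24}$, $dy_{14}+dy_{23}$. *)
Definition selfdual12 := w (e y1) (e y2) + w (e y3) (e y4).
Definition selfdual13 := w (e y1) (e y3) - w (e y2) (e y4).
Definition selfdual14 := w (e y1) (e y4) + w (e y2) (e y3).

Lemma horizontal_expand (u v : 'rV[K]_5) :
  let d j k := u 0 j * v 0 k - v 0 j * u 0 k in
  w u v = d y1 y2 *: w (e y1) (e y2) + d y3 y4 *: w (e y3) (e y4)
    + d y1 y3 *: w (e y1) (e y3) + d y2 y4 *: w (e y2) (e y4)
    + d y1 y4 *: w (e y1) (e y4) + d y2 y3 *: w (e y2) (e y3).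
Proof.
rewrite /= {1}(row_sum_delta u) {1}(row_sum_delta v) skew_suml //.
under eq_bigr do rewrite skew_sumr //.
(* Of the 25 terms, those involving [ys] vanish by horizontality and the remaining diagonal ones by
   skewness; the rewrites below fold the last twelve into six. *)
rewrite !sum_ord5 !w_horizontal !w_horizontalr !scaler0 !addr0 !skew_diag //.
rewrite (w_skewbil.2 (e y1) (e y2)) (w_skewbil.2 (e y1) (e y3)).
rewrite (w_skewbil.2 (e y1) (e y4)) (w_skewbil.2 (e y2) (e y3)).
rewrite (w_skewbil.2 (e y2) (e y4)) (w_skewbil.2 (e y3) (e y4)).
move: (w _ _) (w _ _) (w _ _) (w _ _) (w _ _) (w _ _) => w1 w2 w3 w4 w5 w6.
by apply/matrixP => k l; rewrite !mxE; ring.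
Qed.

(** The left side is [horiz_plus] with [star] and [dydy] unfolded. Each pair of 2-forms exchanged by
    the star, with its sign, groups into one self-dual basis form. *)
Lemma selfdual_expand (u v : 'rV[K]_5) :
  let d j k := u 0 j * v 0 k - v 0 j * u 0 k in
  let c j k := w (e j) (e k) in
  2^-1 *: (w u v + (d y3 y4 *: c y1 y2 + d y1 y2 *: c y3 y4
    - d y2 y4 *: c y1 y3 - d y1 y3 *: c y2 y4
    + d y2 y3 *: c y1 y4 + d y1 y4 *: c y2 y3)) =
  2^-1 *: ((d y1 y2 + d y3 y4) *: selfdual12 + (d y1 y3 - d y2 y4) *: selfdual13
    + (d y1 y4 + d y2 y3) *: selfdual14).
Proof.
rewrite /= {1}horizontal_expand /selfdual12 /selfdual13 /selfdual14.
move: (w _ _) (w _ _) (w _ _) (w _ _) (w _ _) (w _ _) => w1 w2 w3 w4 w5 w6.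
congr (_ *: _); apply/matrixP => k l; rewrite !mxE; ring.
Qed.

Lemma selfdual_eq0P :
  let d j k (u v : 'rV[K]_5) := u 0 j * v 0 k - v 0 j * u 0 k in
  let c j k := w (e j) (e k) in
  (forall u v, 2^-1 *: (w u v + (d y3 y4 u v *: c y1 y2 + d y1 y2 u v *: c y3 y4
    - d y2 y4 u v *: c y1 y3 - d y1 y3 u v *: c y2 y4
    + d y2 y3 u v *: c y1 y4 + d y1 y4 u v *: c y2 y3)) = 0) <->
  [/\ selfdual12 = 0, selfdual13 = 0 & selfdual14 = 0].
Proof.
move=> d c; split=> [H|[s2 s3 s4] u v]; last first.
  by rewrite selfdual_expand s2 s3 s4 !scaler0 !addr0 scaler0.
have H' j k := etrans (esym (selfdual_expand (e j) (e k))) (H (e j) (e k)).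
have n2 : (2^-1 : K) != 0 by rewrite invr_eq0 pnatr_eq0.
(* On each of these three pairs exactly one self-dual basis form is nonzero, with value 1. *)
have := (H' y1 y2, H' y1 y3, H' y1 y4).
rewrite /= !mxE /= !(mul0r, mulr0, mulr1, oppr0, addr0, scale0r, scale1r, add0r).
by case=> [[/eqP + /eqP +] /eqP +]; rewrite !scaler_eq0 (negPf n2) /=
  => /eqP -> /eqP -> /eqP ->.
Qed.

Let linE := (skewDl w_skewbil, skewZl w_skewbil,
  skewDr w_skewbil, skewZr w_skewbil, w_horizontal,
  w_horizontalr, scaler0, addr0).

(** The arguments are [V 0 0] and [V 1 0] with arbitrary vertical parts, which [w] does not see.
    Modulo those parts the bivector $V_{00'}\wedge V_{10'}$ is self-dual: ['i ^+ 2 = -1] supplies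
    the minus sign in [selfdual13]. *)
Lemma horizontal_frame0 a b :
  w (2^-1 *: (e y1 - 'i *: e y2) - a *: e ys)
    (2^-1 *: (e y3 - 'i *: e y4) + b *: e ys)
  = 4^-1 *: (selfdual13 - 'i *: selfdual14).
Proof.
have i2 := sqrCi K; have n2 : (2 : K) != 0 by rewrite pnatr_eq0.
rewrite -!scaleNr !linE /selfdual13 /selfdual14.
move: (w _ _) (w _ _) (w _ _) (w _ _) => w1 w2 w3 w4.
apply/matrixP => k l; rewrite !mxE; field: i2; done.
Qed.

Lemma horizontal_frame2 a b :
  w (2^-1 *: (- e y3 - 'i *: e y4) + a *: e ys)
    (2^-1 *: (e y1 + 'i *: e y2) + b *: e ys)
  = 4^-1 *: (selfdual13 + 'i *: selfdual14).
Proof.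
have i2 := sqrCi K; have n2 : (2 : K) != 0 by rewrite pnatr_eq0.
rewrite -!scaleNr -(scaleN1r (e y3)) !linE /selfdual13 /selfdual14.
rewrite (w_skewbil.2 (e y1) (e y3)) (w_skewbil.2 (e y1) (e y4)).
rewrite (w_skewbil.2 (e y2) (e y3)) (w_skewbil.2 (e y2) (e y4)).
move: (w _ _) (w _ _) (w _ _) (w _ _) => w1 w2 w3 w4.
apply/matrixP => k l; rewrite !mxE; field: i2; done.
Qed.

(** The two terms are ['i / 2] times the coefficients of $dy_{12}$ and $dy_{34}$ respectively; only
    their sum is a self-dual quantity. *)
Lemma horizontal_frame1 a b c d :
  w (2^-1 *: (e y1 - 'i *: e y2) - a *: e ys)
    (2^-1 *: (e y1 + 'i *: e y2) + b *: e ys)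
  + w (2^-1 *: (- e y3 - 'i *: e y4) + c *: e ys)
      (2^-1 *: (e y3 - 'i *: e y4) + d *: e ys)
  = ('i / 2) *: selfdual12.
Proof.
have i2 := sqrCi K; have n2 : (2 : K) != 0 by rewrite pnatr_eq0.
rewrite -!scaleNr -(scaleN1r (e y3)) !linE /selfdual12 !skew_diag //.
rewrite (w_skewbil.2 (e y1) (e y2)) (w_skewbil.2 (e y3) (e y4)).
move: (w _ _) (w _ _) => w1 w2.
apply/matrixP => k l; rewrite !mxE; field: i2; done.
Qed.

Lemma frame_eq0P :
  [/\ selfdual12 = 0, selfdual13 = 0 & selfdual14 = 0] <->
  [/\ 4^-1 *: (selfdual13 - 'i *: selfdual14) = 0, ('i / 2) *: selfdual12 = 0 &
      4^-1 *: (selfdual13 + 'i *: selfdual14) = 0].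
Proof.
have n2 : (2 : K) != 0 by rewrite pnatr_eq0.
have n4 : (4^-1 : K) != 0 by rewrite invr_eq0 pnatr_eq0.
have ni : ('i : K) / 2 != 0 by rewrite mulf_neq0 ?invr_eq0 ?neq0Ci.
have sE (c : K) (x : 'M[K]_n) : c != 0 -> c *: x = 0 -> x = 0.
  by move=> /negPf c0 /eqP; rewrite scaler_eq0 c0 => /eqP.
split=> [[-> -> ->]|[]]; first by rewrite !scaler0 subr0 addr0 !scaler0.
move=> /(sE _ _ n4) h1 /(sE _ _ ni) -> /(sE _ _ n4) h2.
(* The two combinations add up to twice [selfdual13]. *)
have h3 : selfdual13 = 0.
  apply: (sE 2) => //; rewrite scaler_nat mulr2n.
  by rewrite -[X in X + _](subrK ('i *: selfdual14)) h1 add0r addrC h2.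
split=> //; apply: (sE 'i); first exact: neq0Ci.
by rewrite -h2 h3 add0r.
Qed.

End HorizontalForms.

(** * Linearity of the connection form and its values on the frame *)

Section ConnectionFrame.
Variables (R : realType) (n : nat).
Variables (Phi : 'I_2 -> 'I_2 -> heis R -> 'M[R[i]]_n) (PhiT : heis R -> 'M[R[i]]_n).

Lemma tvec_linE (a : R[i]) (u v : tvec R) j : (a *: u + v) 0 j = a * u 0 j + v 0 j.
Proof. by rewrite mxE [X in X + _]mxE. Qed.

Lemma thetaAB_linear A B p a (u v : tvec R) :
  thetaAB A B p (a *: u + v) = a * thetaAB A B p u + thetaAB A B p v.
Proof.
rewrite /thetaAB /dy !tvec_linE.
by case: (ord2P A) => ->; case: (ord2P B) => -> /=; ring.
Qed.

Lemma theta_linear p a (u v : tvec R) :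
  theta p (a *: u + v) = a * theta p u + theta p v.
Proof. by rewrite /theta /dy !tvec_linE; ring. Qed.

Lemma dirder_theta_linear a (u v v' : tvec R) :
  dirder_theta u (a *: v + v') = a * dirder_theta u v + dirder_theta u v'.
Proof. by rewrite /dirder_theta !tvec_linE; ring. Qed.

Lemma connection_linear (P : 'I_2 -> 'I_2 -> heis R -> 'M[R[i]]_n) PT p a u v :
  connection P PT p (a *: u + v) = a *: connection P PT p u + connection P PT p v.
Proof.
rewrite /connection theta_linear scalerDl -scalerA [in RHS]scalerDr addrACA.
congr (_ + _); rewrite scaler_sumr -big_split; apply: eq_bigr => A _ /=.
rewrite scaler_sumr -big_split; apply: eq_bigr => B _ /=.
by rewrite thetaAB_linear scalerDl -scalerA.
Qed.

Lemma dirder_linear a (u v : tvec R) (f : heis R -> 'M[R[i]]_n) p :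
  dirder (a *: u + v) f p = a *: dirder u f p + dirder v f p.
Proof.
rewrite /dirder scaler_sumr -big_split; apply: eq_bigr => j _ /=.
by rewrite tvec_linE scalerDl -scalerA.
Qed.

Lemma connection_V p A B : connection Phi PhiT p (V A B p) = Phi A B p.
Proof.
rewrite /connection theta_V scale0r addr0 !sum_ord2 !thetaAB_V.
by case: (ord2P A) => ->; case: (ord2P B) => -> /=;
  rewrite !scale0r scale1r ?addr0 ?add0r.
Qed.

Lemma connection_T p : connection Phi PhiT p (T p) = PhiT p.
Proof.
by rewrite /connection theta_T scale1r !sum_ord2 !thetaAB_T !scale0r !addr0 add0r.
Qed.

End ConnectionFrame.

(** The left side is $d\theta$ on two frame fields. As [theta] vanishes on both, it is minus the
    $T$-component of their Lie bracket. *)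
Lemma dtheta_V (R : realType) A B C D (p : heis R) :
  dirder_theta (V A B p) (V C D p) - dirder_theta (V C D p) (V A B p) =
  if (A == C) || (B == D) then 0 else if B == 0 then - 2 else 2.
Proof.
have i2 := sqrCi R[i]; have n2 := nonzero2 R.
rewrite /dirder_theta !V_coord.
case: (ord2P A) => ->; case: (ord2P B) => ->; case: (ord2P C) => ->;
  case: (ord2P D) => -> /=; field: i2.
all: done.
Qed.

(** * Curvature on the frame, and its horizontal and vertical parts *)

Section Curvature.
Variables (R : realType) (n : nat).
Variables (Phi : 'I_2 -> 'I_2 -> heis R -> 'M[R[i]]_n) (PhiT : heis R -> 'M[R[i]]_n).
Hypothesis Phi_smooth : forall A B, smooth (Phi A B).
Hypothesis PhiT_smooth : smooth PhiT.
Local Notation F := (curvature (connection Phi PhiT)).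

Lemma curvatureE p u v :
  F p u v =
    connection (fun A B => dirder u (Phi A B)) (dirder u PhiT) p v
    - connection (fun A B => dirder v (Phi A B)) (dirder v PhiT) p u
    + (dirder_theta u v - dirder_theta v u) *: PhiT p
    + mxbracket (connection Phi PhiT p u) (connection Phi PhiT p v).
Proof.
rewrite /curvature /dform1 !dirder_connection // /wedge_mx /mxbracket.
by rewrite scalerBl opprD [in LHS](addrACA (connection _ _ _ _)).
Qed.

Lemma curvature_skew p u v : F p v u = - F p u v.
Proof. by rewrite /curvature /dform1 /wedge_mx opprD !opprB. Qed.

(** A directional derivative is additive only on differentiable functions, so linearity is read off
    the Leibniz expansion, where it is pointwise algebra. *)
Lemma dirder_connection_linear p a u u' v :
  dirder v (fun q => connection Phi PhiT q (a *: u + u')) p =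
  a *: dirder v (fun q => connection Phi PhiT q u) p
  + dirder v (fun q => connection Phi PhiT q u') p.
Proof.
rewrite !dirder_connection // connection_linear dirder_theta_linear.
by rewrite scalerDl -scalerA [in RHS]scalerDr addrACA.
Qed.

Lemma curvature_skew_bilinear p : skew_bilinear (F p).
Proof.
split=> [a u u' v|u v]; last exact: curvature_skew.
rewrite /curvature /dform1 /wedge_mx dirder_linear dirder_connection_linear.
rewrite connection_linear.
suff lin (X X' Y Y' B C C' : 'M[R[i]]_n) :
    a *: X + X' - (a *: Y + Y') + ((a *: C + C') *m B - B *m (a *: C + C')) =
    a *: (X - Y + (C *m B - B *m C)) + (X' - Y' + (C' *m B - B *m C')).
  exact: lin.
rewrite mulmxDl mulmxDr -scalemxAl -scalemxAr scalerDr !scalerBr !opprD.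
rewrite (addrACA (a *: X)) (addrACA (a *: (C *m B))).
exact: addrACA.
Qed.

Lemma curvature_VV p A B C D :
  F p (V A B p) (V C D p) =
    vder (V A B) (Phi C D) p - vder (V C D) (Phi A B) p
    + (dirder_theta (V A B p) (V C D p) - dirder_theta (V C D p) (V A B p)) *: PhiT p
    + mxbracket (Phi A B p) (Phi C D p).
Proof. by rewrite curvatureE !connection_V. Qed.

Lemma curvature_VT p A B :
  F p (V A B p) (T p) =
    vder (V A B) PhiT p - vder (@T R) (Phi A B) p + mxbracket (Phi A B p) (PhiT p).
Proof.
rewrite curvatureE !connection_V !connection_T.
(* [dirder_theta] reads only the first four coordinates, where [T] is zero. *)
rewrite (_ : _ - dirder_theta _ _ = 0) ?scale0r ?addr0 //.
by rewrite /dirder_theta !T_coord /= !(mulr0, mul0r, subr0, addr0).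
Qed.

Lemma curvature_frame0 p :
  F p (V 0 0 p) (V 1 0 p) =
  vder (V 0 0) (Phi 1 0) p - vder (V 1 0) (Phi 0 0) p
  + mxbracket (Phi 0 0 p) (Phi 1 0 p).
Proof.
by rewrite curvature_VV dtheta_V scale0r addr0.
Qed.

Lemma curvature_frame2 p :
  F p (V 0 1 p) (V 1 1 p) =
  vder (V 0 1) (Phi 1 1) p - vder (V 1 1) (Phi 0 1) p
  + mxbracket (Phi 0 1 p) (Phi 1 1 p).
Proof.
by rewrite curvature_VV dtheta_V scale0r addr0.
Qed.

Lemma curvature_frame1 p :
  F p (V 0 0 p) (V 1 1 p) + F p (V 0 1 p) (V 1 0 p) =
  vder (V 0 1) (Phi 1 0) p + vder (V 0 0) (Phi 1 1) p
  - vder (V 1 0) (Phi 0 1) p - vder (V 1 1) (Phi 0 0) p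
  + mxbracket (Phi 0 0 p) (Phi 1 1 p) + mxbracket (Phi 0 1 p) (Phi 1 0 p).
Proof.
have F0011 := curvature_VV p 0 0 1 1; have F0110 := curvature_VV p 0 1 1 0.
rewrite dtheta_V /= in F0011; rewrite dtheta_V /= in F0110.
apply: etrans (congr2 +%R F0011 F0110) _.
(* Here [g] stands for [PhiT p]: the defects -2 and 2 cancel, and the rest is reordering. *)
suff sum_eq (a b c d e f g : 'M[R[i]]_n) :
  a - b + - 2 *: g + e + (c - d + 2 *: g + f) = c + a - d - b + e + f by exact: sum_eq.
rewrite scaleNr (addrAC (a - b)) (addrAC (c - d)) addrACA addNr addr0.
rewrite addrACA addrA; congr (_ + _ + _).
by rewrite addrACA -opprD (addrC a) (addrC b) opprD addrA.
Qed.

Lemma horiz_skew_bilinear p : skew_bilinear (horiz F p).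
Proof.
split=> [a u u' v|u v].
  exact: (horizontal_part_linear (curvature_skew_bilinear p) (theta_linear p) (theta_T p)).
exact: (horizontal_part_skew (curvature_skew_bilinear p) (theta_T p)).
Qed.

Lemma horiz_ys p v : horiz F p (pd R ys) v = 0.
Proof.
(* Contraction with [T] is thereby turned into the hypothesis on [ys] under which horizontal forms
   were treated. *)
have -> : pd R ys = (- 'i) *: @T R p.
  by rewrite /T scalerA mulNr -expr2 sqrCi opprK scale1r.
rewrite (skewZl (horiz_skew_bilinear p)).
rewrite (_ : horiz F p (T p) v = 0) ?scaler0 //.
exact: (horizontal_partX (curvature_skew_bilinear p) (theta p) (T p)).
Qed.

Lemma horiz_V p A B C D :
  horiz F p (V A B p) (V C D p) = F p (V A B p) (V C D p).
Proof.
exact: (horizontal_part_id (F p) (theta_T p) (theta_V _ _ p) (theta_V _ _ p)).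
Qed.

Lemma horiz_plus_eq0 p :
  let w := horiz F p in
  (forall u v, horiz_plus F p u v = 0) <->
  [/\ selfdual12 w = 0, selfdual13 w = 0 & selfdual14 w = 0].
Proof.
exact: (selfdual_eq0P (horiz_skew_bilinear p) (horiz_ys p)).
Qed.

(** The hub of the first claim: these three curvature values are at once the coefficients of the
    quadratic form in $(\pi_{0'},\pi_{1'})$ and the left sides of the three equations. *)
Lemma horiz_plus_frame p :
  (forall u v, horiz_plus F p u v = 0) <->
  [/\ F p (V 0 0 p) (V 1 0 p) = 0,
      F p (V 0 0 p) (V 1 1 p) + F p (V 0 1 p) (V 1 0 p) = 0
    & F p (V 0 1 p) (V 1 1 p) = 0].
Proof.
have wP := horiz_skew_bilinear p; have w0 := horiz_ys p.
have f0 := etrans (esym (horiz_V p 0 0 1 0))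
  (horizontal_frame0 wP w0 _ _).
have f1 := etrans (congr2 +%R (esym (horiz_V p 0 0 1 1)) (esym (horiz_V p 0 1 1 0)))
  (horizontal_frame1 wP w0 _ _ _ _).
have f2 := etrans (esym (horiz_V p 0 1 1 1))
  (horizontal_frame2 wP w0 _ _).
apply: (iff_trans (horiz_plus_eq0 p)); apply: (iff_trans (frame_eq0P _)).
split=> -[h0 h1 h2].
  by split; [exact: etrans f0 h0 | exact: etrans f1 h1 | exact: etrans f2 h2].
by split; [exact: etrans (esym f0) h0 | exact: etrans (esym f1) h1
          | exact: etrans (esym f2) h2].
Qed.

Lemma horiz_plus_eqs p :
  (forall u v, horiz_plus F p u v = 0) <->
  [/\ vder (V 0 0) (Phi 1 0) p - vder (V 1 0) (Phi 0 0) p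
        + mxbracket (Phi 0 0 p) (Phi 1 0 p) = 0,
      vder (V 0 1) (Phi 1 0) p + vder (V 0 0) (Phi 1 1) p
        - vder (V 1 0) (Phi 0 1) p - vder (V 1 1) (Phi 0 0) p
        + mxbracket (Phi 0 0 p) (Phi 1 1 p)
        + mxbracket (Phi 0 1 p) (Phi 1 0 p) = 0
    & vder (V 0 1) (Phi 1 1) p - vder (V 1 1) (Phi 0 1) p
        + mxbracket (Phi 0 1 p) (Phi 1 1 p) = 0].
Proof.
apply: (iff_trans (horiz_plus_frame p)).
have f0 := esym (curvature_frame0 p).
have f1 := esym (curvature_frame1 p).
have f2 := esym (curvature_frame2 p).
split=> -[h0 h1 h2].
  by split; [exact: etrans f0 h0 | exact: etrans f1 h1 | exact: etrans f2 h2].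
by split; [exact: etrans (esym f0) h0 | exact: etrans (esym f1) h1
          | exact: etrans (esym f2) h2].
Qed.

Lemma curvature_Vpi pi0 pi1 p :
  F p (Vpi pi0 pi1 0 p) (Vpi pi0 pi1 1 p) =
  pi0 ^+ 2 *: F p (V 0 0 p) (V 1 0 p)
  - (pi0 * pi1) *: (F p (V 0 0 p) (V 1 1 p) + F p (V 0 1 p) (V 1 0 p))
  + pi1 ^+ 2 *: F p (V 0 1 p) (V 1 1 p).
Proof.
exact: (skew_quadratic (curvature_skew_bilinear p)).
Qed.

Lemma curvature_Vpi_eq0 p :
  (forall pi0 pi1 : R[i], (pi0, pi1) <> (0, 0) ->
     F p (Vpi pi0 pi1 0 p) (Vpi pi0 pi1 1 p) = 0) <->
  [/\ F p (V 0 0 p) (V 1 0 p) = 0,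
      F p (V 0 0 p) (V 1 1 p) + F p (V 0 1 p) (V 1 0 p) = 0
    & F p (V 0 1 p) (V 1 1 p) = 0].
Proof.
apply: iff_trans (quadratic_eq0P _ _ _).
split=> H a b ab_neq0; first exact: etrans (esym (curvature_Vpi a b p)) (H a b ab_neq0).
exact: etrans (curvature_Vpi a b p) (H a b ab_neq0).
Qed.

(** Completeness of the frame, checked in each of the five coordinates. It carries vanishing on
    frame vectors over to all tangent vectors. *)
Lemma tvec_frame p (u : tvec R) :
  u = \sum_A \sum_B thetaAB A B p u *: V A B p + theta p u *: T p.
Proof.
have i2 := sqrCi R[i]; have n2 := nonzero2 R.
apply/rowP => j.
suff -> : u 0 j = \sum_A \sum_B thetaAB A B p u * V A B p 0 j + theta p u * T p 0 j.
  rewrite [RHS]mxE summxE; congr (_ + _); last by rewrite [RHS]mxE.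
  apply: eq_bigr => A _; rewrite summxE; apply: eq_bigr => B _.
  by rewrite [RHS]mxE.
under eq_bigr do under eq_bigr do rewrite V_coord.
rewrite T_coord !sum_ord2 /thetaAB /theta /dy /=.
have : j \in [:: y1; y2; y3; y4; ys] by case: j => [[|[|[|[|[|]]]]]].
by rewrite !inE => /or4P[|||/orP[]] /eqP -> /=; field: i2.
Qed.

(** Evaluating $\theta\wedge\iota_TF$ on a frame vector and [T] gives back $F(V_{AB'},T)$.
    Conversely, these values together with $F(T,T)=0$ determine $\iota_TF$. *)
Lemma vert_eq0 p :
  (forall u v, vert F p u v = 0) <->
  (forall A B, F p (V A B p) (T p) = 0).
Proof.
split=> [H A B|H u v].
  have := H (V A B p) (T p).
  rewrite /vert /wedge11 theta_T theta_V scale0r scale1r sub0r /contract2.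
  by rewrite -(curvature_skew_bilinear p).2.
have FT x : F p (T p) x = 0.
  rewrite (curvature_skew_bilinear p).2; apply/eqP; rewrite oppr_eq0; apply/eqP.
  apply: (etrans (congr1 ((F p)^~ (T p)) (tvec_frame p x))).
  apply: (etrans (skew_frame (curvature_skew_bilinear p) (fun A B => thetaAB A B p x)
    (theta p x) (fun A B => V A B p) (T p))).
  apply: big1 => A _; apply: big1 => B _.
  by rewrite (H A B) scaler0.
by rewrite /vert /wedge11 /contract2 !FT !scaler0 subr0.
Qed.

End Curvature.

Theorem proposition4p3 (R : realType) (n : nat)
    (Phi : 'I_2 -> 'I_2 -> heis R -> 'M[R[i]]_n) (PhiT : heis R -> 'M[R[i]]_n)
    (Phi_smooth : forall A B, smooth (Phi A B)) (PhiT_smooth : smooth PhiT) :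
  let F := curvature (connection Phi PhiT) in
  (((forall p u v, horiz_plus F p u v = 0) <->
    (forall pi0 pi1 : R[i], (pi0, pi1) <> (0, 0) ->
       forall p, F p (Vpi pi0 pi1 0 p) (Vpi pi0 pi1 1 p) = 0))
   /\
   ((forall p u v, horiz_plus F p u v = 0) <->
    (forall p,
      [/\ vder (V 0 0) (Phi 1 0) p - vder (V 1 0) (Phi 0 0) p
            + mxbracket (Phi 0 0 p) (Phi 1 0 p) = 0,
          vder (V 0 1) (Phi 1 0) p + vder (V 0 0) (Phi 1 1) p
            - vder (V 1 0) (Phi 0 1) p - vder (V 1 1) (Phi 0 0) p
            + mxbracket (Phi 0 0 p) (Phi 1 1 p)
            + mxbracket (Phi 0 1 p) (Phi 1 0 p) = 0
        & vder (V 0 1) (Phi 1 1) p - vder (V 1 1) (Phi 0 1) p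
            + mxbracket (Phi 0 1 p) (Phi 1 1 p) = 0])))
  /\
  ((forall p u v, vert F p u v = 0) <->
   (forall (A B : 'I_2) p,
      vder (V A B) PhiT p - vder (@T R) (Phi A B) p
        + mxbracket (Phi A B p) (PhiT p) = 0)).
Proof.
move=> F; split; [split|].
(* Everything is settled at a fixed point, which allows the quantifiers over [p] and over the spinor
   to be exchanged. *)
- split=> [Fp pi0 pi1 pi_neq0 p | Fpi p].
    exact: (curvature_Vpi_eq0 Phi_smooth PhiT_smooth p).2
      ((horiz_plus_frame Phi_smooth PhiT_smooth p).1 (Fp p)) _ _ pi_neq0.
  apply/(horiz_plus_frame Phi_smooth PhiT_smooth).
  apply/(curvature_Vpi_eq0 Phi_smooth PhiT_smooth) => pi0 pi1 pi_neq0.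
  exact: Fpi.
- by split=> H p; apply/(horiz_plus_eqs Phi_smooth PhiT_smooth).
- split=> [Fv A B p | FT p].
    rewrite -(curvature_VT Phi_smooth PhiT_smooth).
    exact: (vert_eq0 Phi_smooth PhiT_smooth p).1 (Fv p) A B.
  apply/(vert_eq0 Phi_smooth PhiT_smooth) => A B.
  by rewrite (curvature_VT Phi_smooth PhiT_smooth).
Qed.
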